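(* Let $G$ be a group and $\mathcal{H}$ be a Hilbert space. The following are equivalent: (1) there exist real numbers $\kappa>0$ and $0<\delta<1$ such that for every $0<\varepsilon<\delta$ and every $\varepsilon$-representation $\varphi\colon G\to U(\mathcal{H})$ there exists a unitary representation $\pi\colon G\to U(\mathcal{H})$ such that $\|\varphi(x)-\pi(x)\|\leq\kappa\varepsilon$ for all $x\in G$; (2) there exist real numbers $\kappa_1,\kappa_2>0$, $0<\delta<1$, and $p>1$ such that for every $0<\varepsilon<1$ with $\kappa_1\varepsilon^{p-1}\leq\delta^{p-1}$ and every $\varepsilon$-representation $\varphi\colon G\to U(\mathcal{H})$ there exists a unital positive definite $\kappa_1\varepsilon^p$-representation $\psi\colon G\to B(\mathcal{H})$ such that $\|\varphi(x)-\psi(x)\|\leq\kappa_2\varepsilon$ for all $x\in G$.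
   Context: Groups are discrete. $B(\mathcal{H})$ is the algebra of bounded operators on $\mathcal{H}$ with the operator norm $\|\cdot\|$ and $U(\mathcal{H})$ is its group of unitary operators. For $\varepsilon\geq 0$, a map $\varphi\colon G\to B(\mathcal{H})$ (not assumed to be a homomorphism) is an $\varepsilon$-representation if $\|\varphi(xy)-\varphi(x)\varphi(y)\|\leq\varepsilon$ for all $x,y\in G$. A unitary representation is a group homomorphism $G\to U(\mathcal{H})$. A map $\psi\colon G\to B(\mathcal{H})$ is unital if $\psi(e)=\mathrm{Id}_{\mathcal{H}}$, and positive definite if for every finite set $\{x_1,\dots,x_n\}\subset G$ the operator matrix $(\psi(x_i^{-1}x_j))_{ij}$ is positive (as an operator on $\mathcal{H}^n$). *)

(* Defs.v *)
From HB Require Import structures.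
From mathcomp Require Import all_boot all_order all_algebra.
From mathcomp Require Import sesquilinear.
From mathcomp Require Import complex.
From mathcomp Require Import boolp classical_sets reals.
From mathcomp Require Import topology normedtype exp.

Set Implicit Arguments.
Unset Strict Implicit.
Unset Printing Implicit Defensive.

Import Order.TTheory GRing.Theory Num.Theory.
Import numFieldNormedType.Exports.

Local Open Scope classical_set_scope.
Local Open Scope ring_scope.

(* The inner product is linear in its first argument and conjugate-linear in *)
(* the second.  The norm of a normed module over R[i] takes its values in    *)
(* R[i] (in fact in the nonnegative reals of R[i]).                          *)
HB.mixin Record NormedModule_isHilbert (R : realType) H
    of CompleteNormedModule R[i] H := {
  inner : {dot H for (@Num.conj R[i])};
  sqr_norm_inner : forall v : H, `|v| ^+ 2 = inner v v
}.

#[short(type="hilbertType")]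
HB.structure Definition Hilbert (R : realType) :=
  {H of NormedModule_isHilbert R H & CompleteNormedModule R[i] H}.

Section BoundedOp.
Context (R : realType) (H : hilbertType R).

Record boundedOp := BoundedOp {
  bop_fun :> H -> H;
  bop_linear : linear bop_fun;
  bop_bounded : exists M : R[i], forall v, `|bop_fun v| <= M * `|v|
}.

HB.instance Definition _ (S : boundedOp) :=
  GRing.isLinear.Build R[i] H H *:%R (bop_fun S) (bop_linear S).

HB.instance Definition _ := gen_eqMixin boundedOp.
HB.instance Definition _ := gen_choiceMixin boundedOp.

Lemma bop_eqP (S T : boundedOp) : (forall v, S v = T v) -> S = T.
Proof.
case: S T => [f fl fb] [g gl gb] /= /funext fg.
by subst g; congr BoundedOp; exact: Prop_irrelevance.
Qed.

Fact bop0_linear : linear (fun _ : H => 0 : H).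
Proof. by move=> a u v; rewrite scaler0 addr0. Qed.

Fact bop0_bounded : exists M : R[i], forall v : H, `|0 : H| <= M * `|v|.
Proof. by exists 0 => v; rewrite normr0 mul0r. Qed.

Definition bop0 := BoundedOp bop0_linear bop0_bounded.

Fact bop1_linear : linear (fun v : H => v).
Proof. by []. Qed.

Fact bop1_bounded : exists M : R[i], forall v : H, `|v| <= M * `|v|.
Proof. by exists 1 => v; rewrite mul1r. Qed.

Definition bop1 := BoundedOp bop1_linear bop1_bounded.

Fact bop_opp_linear (S : boundedOp) : linear (fun v => - S v).
Proof. by move=> a u v; rewrite linearP opprD scalerN. Qed.

Fact bop_opp_bounded (S : boundedOp) :
  exists M : R[i], forall v, `|- S v| <= M * `|v|.
Proof. by have [M SM] := bop_bounded S; exists M => v; rewrite normrN. Qed.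

Definition bop_opp S := BoundedOp (bop_opp_linear S) (bop_opp_bounded S).

Fact bop_add_linear (S T : boundedOp) : linear (fun v => S v + T v).
Proof. by move=> a u v; rewrite !linearP scalerDr addrACA. Qed.

Fact bop_add_bounded (S T : boundedOp) :
  exists M : R[i], forall v, `|S v + T v| <= M * `|v|.
Proof.
have [M SM] := bop_bounded S; have [N TN] := bop_bounded T.
by exists (M + N) => v; rewrite mulrDl (le_trans (ler_normD _ _))// lerD.
Qed.

Definition bop_add S T := BoundedOp (bop_add_linear S T) (bop_add_bounded S T).

Fact bop_comp_linear (S T : boundedOp) : linear (fun v => S (T v)).
Proof. by move=> a u v; rewrite !linearP. Qed.

Fact bop_comp_bounded (S T : boundedOp) :
  exists M : R[i], forall v, `|S (T v)| <= M * `|v|.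
Proof.
have [M SM] := bop_bounded S; have [N TN] := bop_bounded T.
exists (`|M| * N) => v; have MR : `|S (T v)| <= `|M| * `|T v|.
  rewrite -[X in _ * X]normr_id -normrM.
  by rewrite (ger0_norm (le_trans _ (SM (T v)))).
by rewrite (le_trans MR)// -mulrA ler_wpM2l.
Qed.

Definition bop_comp S T :=
  BoundedOp (bop_comp_linear S T) (bop_comp_bounded S T).

Fact bop_addA : associative bop_add.
Proof. by move=> S T U; apply: bop_eqP => v /=; rewrite addrA. Qed.

Fact bop_addC : commutative bop_add.
Proof. by move=> S T; apply: bop_eqP => v /=; rewrite addrC. Qed.

Fact bop_add0 : left_id bop0 bop_add.
Proof. by move=> S; apply: bop_eqP => v /=; rewrite add0r. Qed.

Fact bop_addN : left_inverse bop0 bop_opp bop_add.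
Proof. by move=> S; apply: bop_eqP => v /=; rewrite addNr. Qed.

HB.instance Definition _ :=
  GRing.isZmodule.Build boundedOp bop_addA bop_addC bop_add0 bop_addN.

Fact bop_compA : associative bop_comp.
Proof. by move=> S T U; apply: bop_eqP. Qed.

Fact bop_comp1l : left_id bop1 bop_comp.
Proof. by move=> S; apply: bop_eqP. Qed.

Fact bop_comp1r : right_id bop1 bop_comp.
Proof. by move=> S; apply: bop_eqP. Qed.

Fact bop_compDl : left_distributive bop_comp +%R.
Proof. by move=> S T U; apply: bop_eqP. Qed.

Fact bop_compDr : right_distributive bop_comp +%R.
Proof. by move=> S T U; apply: bop_eqP => v /=; rewrite linearD. Qed.

HB.instance Definition _ := GRing.Zmodule_isPzRing.Build boundedOp
  bop_compA bop_comp1l bop_comp1r bop_compDl bop_compDr.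

Definition opnorm (S : boundedOp) : R :=
  sup [set complex.Re `|S v| | v in [set v : H | `|v| <= 1]].

(* S is the adjoint of T; it is unique since the inner product is definite. *)
Definition is_adjoint (T S : boundedOp) :=
  forall u v : H, inner (T u) v = inner u (S v).

Definition unitary (T : boundedOp) :=
  exists S, [/\ is_adjoint T S, T * S = 1 & S * T = 1].

Record unitaryOp := UnitaryOp {
  uop_val :> boundedOp;
  uopP : unitary uop_val
}.

HB.instance Definition _ := gen_eqMixin unitaryOp.
HB.instance Definition _ := gen_choiceMixin unitaryOp.

Lemma uop_inj : injective uop_val.
Proof.
case=> [S Su] [T Tu] /= ST; subst T.
by congr UnitaryOp; exact: Prop_irrelevance.
Qed.

Fact uop1_unitary : unitary 1.
Proof. by exists 1; split; rewrite ?mul1r. Qed.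

Definition uop1 := UnitaryOp uop1_unitary.

Fact uop_mul_unitary (S T : unitaryOp) : unitary (uop_val S * uop_val T).
Proof.
have [S' [adjS SS' S'S]] := uopP S; have [T' [adjT TT' T'T]] := uopP T.
exists (T' * S'); split.
- by move=> u v; rewrite adjS adjT.
- by rewrite mulrA -(mulrA (uop_val S)) TT' mulr1.
- by rewrite mulrA -(mulrA T') S'S mulr1.
Qed.

Definition uop_mul S T := UnitaryOp (uop_mul_unitary S T).

Definition adjoint (T : unitaryOp) : boundedOp := sval (cid (uopP T)).

Fact uop_inv_unitary (T : unitaryOp) : unitary (adjoint T).
Proof.
rewrite /adjoint; case: cid => S [/= adjT TS ST]; exists T; split=> // u v.
by rewrite [LHS]hermC [RHS]hermC /= adjT.
Qed.

Definition uop_inv T := UnitaryOp (uop_inv_unitary T).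

Fact uop_mulA : associative uop_mul.
Proof. by move=> S T U; apply: uop_inj; rewrite /= mulrA. Qed.

Fact uop_mul1 : left_id uop1 uop_mul.
Proof. by move=> S; apply: uop_inj; rewrite /= mul1r. Qed.

Fact uop_mulr1 : right_id uop1 uop_mul.
Proof. by move=> S; apply: uop_inj; rewrite /= mulr1. Qed.

Fact uop_mulV : left_inverse uop1 uop_inv uop_mul.
Proof.
by move=> T; apply: uop_inj; rewrite /= /adjoint; case: cid => S [].
Qed.

Fact uop_mulrV : right_inverse uop1 uop_inv uop_mul.
Proof.
by move=> T; apply: uop_inj; rewrite /= /adjoint; case: cid => S [].
Qed.

HB.instance Definition _ := isGroup.Build unitaryOp
  uop_mulA uop_mul1 uop_mulr1 uop_mulV uop_mulrV.

(* An n x n matrix of operators acts on H^n = ('I_n -> H), which carries the *)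
(* inner product <v, w> = \sum_i <v_i, w_i>.                                 *)
Definition opmx_apply n (A : 'I_n -> 'I_n -> boundedOp) (v : 'I_n -> H) :
    'I_n -> H :=
  fun i => \sum_(j < n) A i j (v j).

Definition inner_pow n (v w : 'I_n -> H) : R[i] :=
  \sum_(i < n) inner (v i) (w i).

(* 0 <= z in R[i] means that z is a nonnegative real. *)
Definition opmx_positive n (A : 'I_n -> 'I_n -> boundedOp) :=
  forall v : 'I_n -> H, 0 <= inner_pow (opmx_apply A v) v.

Section Maps.
Context (G : groupType).

Definition eps_representation (eps : R) (phi : G -> boundedOp) :=
  forall x y : G, opnorm (phi (x * y)%g - phi x * phi y) <= eps.

Definition unital (psi : G -> boundedOp) := psi 1%g = 1.

Definition positive_definite (psi : G -> boundedOp) :=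
  forall (n : nat) (x : 'I_n -> G), injective x ->
    opmx_positive (fun i j => psi ((x i)^-1 * x j)%g).

End Maps.
End BoundedOp.

(* Main.v *)
From HB Require Import structures.
Require Import Defs.
From mathcomp Require Import all_boot all_order all_algebra.
From mathcomp Require Import complex reals exp.
From mathcomp Require Import sesquilinear boolp classical_sets.
From mathcomp Require Import topology normedtype.
From mathcomp Require Import ring lra.

(** Stability of unitary representations is equivalent to being able to trade
an epsilon-representation for a positive definite map whose multiplicative
defect is of higher order in epsilon.

If (1) holds, the nearby unitary representation is itself a unital positive
definite map with defect zero, so (2) holds, with p = 2 say.

For the converse, everything rests on one improvement step.  Let psi be the
map that (2) attaches to an e-representation phi, with defect e' = k1 e^p.
Positive definiteness of the two-by-two matrices of psi forces psi(x^-1) to be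
the adjoint of psi(x) ([positive_definite_adjoint]); as psi is unital, the
defect at the pairs (x^-1, x) and (x, x^-1) then says that psi(x) is unitary
up to e'.  An operator that is unitary up to e' <= 1/2 is within 2e' of a
unitary one ([exists_unitary_near]).  Replacing each psi(x) by such a unitary
gives a unitary-valued map phi' of defect at most 9e'
([positive_definite_near_unitary]), at distance O(e) from phi.  Since p > 1,
9e' <= e/2 for small e.  The step therefore halves the defect and moves the
map by O(e); iterating it moves the map by O(e/2^n) at the n-th stage, so the
maps converge in norm to a unitary-valued map of defect zero at distance O(e)
from phi ([stable_of_halving]).

The nearby unitary is the unitary part of the polar decomposition.  To avoid
spectral calculus it is obtained by the Newton-Schulz iteration
T -> T (1 + (1 - T^* T) / 2), which converges quadratically.  Both this
iteration and the iteration of maps are sequences of operators with increments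
and unitarity defects O(1/2^n), and share the limit lemma
[unitary_geometric_cvg]. *)

Set Implicit Arguments.
Unset Strict Implicit.

Import Order.TTheory GRing.Theory Num.Theory.
Import numFieldNormedType.Exports.
Local Open Scope ring_scope.

(** * The norm of vectors and operators *)

Section Norms.
Context {R : realType} {H : hilbertType R}.
Implicit Types (u v w : H) (S T : boundedOp H).

Local Notation "x %:C" := (real_complex R x).

(** The norm of H takes its values in R[i]; estimates are carried out on this
real-valued copy, where order arguments are available. *)
Definition vnorm v : R := complex.Re `|v|.

Lemma vnormE v : `|v| = (vnorm v)%:C.
Proof. by rewrite /vnorm RRe_real// ger0_real. Qed.

Lemma vnorm_ge0 v : 0 <= vnorm v.
Proof. by rewrite -ler0c -vnormE. Qed.

Lemma vnorm0 : vnorm 0 = 0.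
Proof. by rewrite /vnorm normr0. Qed.

Lemma vnorm_eq0 v : vnorm v = 0 -> v = 0.
Proof. by move=> v0; apply: normr0_eq0; rewrite vnormE v0. Qed.

Lemma vnormD u v : vnorm (u + v) <= vnorm u + vnorm v.
Proof. by rewrite -lecR rmorphD/= -!vnormE ler_normD. Qed.

Lemma vnormN v : vnorm (- v) = vnorm v.
Proof. by rewrite /vnorm normrN. Qed.

Lemma vnormZ (a : R[i]) v : vnorm (a *: v) = complex.Re `|a| * vnorm v.
Proof.
apply: (@complexI R); rewrite rmorphM/= -!vnormE normrZ.
by congr (_ * _).
Qed.

Lemma vnorm_sqr v : inner v v = (vnorm v ^+ 2)%:C.
Proof. by rewrite -sqr_norm_inner vnormE rmorphXn. Qed.

Lemma innerC u v : inner v u = (inner u v)^*.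
Proof. by rewrite [LHS]hermC/= expr0 mul1r. Qed.

(** Expand 0 <= <w, w> for w the component of u orthogonal to v. *)
Lemma inner_Cauchy_Schwarz u v : `|inner u v| <= (vnorm u * vnorm v)%:C.
Proof.
have [->|v0] := eqVneq v 0; first by rewrite linear0r normr0 vnorm0 mulr0.
have vp : 0 < vnorm v.
  by rewrite lt0r vnorm_ge0 andbT; apply: contraNneq v0 => /vnorm_eq0 ->.
have := dnorm_ge0 (@inner R H) (u - (inner u v / inner v v) *: v).
rewrite dnormB dnormZ linearZr_LR/= !vnorm_sqr.
set z := inner u v; set s := (vnorm v ^+ 2)%:C; set q := (vnorm u ^+ 2)%:C.
have s0 : 0 < s by rewrite ltcR exprn_gt0.
have -> : (z / s)^* * z = `|z| ^+ 2 / s.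
  by rewrite normCKC rmorphM/= fmorphV/= (CrealP (ger0_real (ltW s0))) mulrAC.
have -> : (`|z| ^+ 2 / s)^* = `|z| ^+ 2 / s.
  by apply/CrealP/ger0_real/divr_ge0; rewrite ?exprn_ge0 ?(ltW s0).
rewrite normrM normfV (gtr0_norm s0) exprMn.
have -> : `|z| ^+ 2 * s^-1 ^+ 2 * s = `|z| ^+ 2 / s.
  by rewrite (expr2 s^-1) -!mulrA mulVf ?gt_eqF ?mulr1.
rewrite opprD addrA addrK subr_ge0 ler_pdivrMr// => zqs.
have uv0 : 0 <= (vnorm u * vnorm v)%:C by rewrite lecR mulr_ge0 ?vnorm_ge0.
rewrite -ler_sqr ?nnegrE//; apply: le_trans zqs _.
by rewrite -[leRHS]rmorphXn/= exprMn [leRHS]rmorphM.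
Qed.

Lemma opnorm_has_sup T :
  has_sup [set complex.Re `|T v| | v in [set v : H | `|v| <= 1]]%classic.
Proof.
split; first by exists (complex.Re `|T 0|), 0 => //=; rewrite normr0.
have [M TM] := bop_bounded T; exists (complex.Re `|M|) => _ [v /= v1 <-].
have TMv := TM v; rewrite -lecR.
rewrite RRe_real ?ger0_real//.
have : `|T v| <= `|M| * `|v|.
  by rewrite -[X in _ * X]normr_id -normrM ger0_norm// (le_trans _ TMv).
by move/le_trans; apply; rewrite ler_piMr.
Qed.

Lemma opnorm_bound T v : vnorm (T v) <= opnorm T * vnorm v.
Proof.
have [->|v0] := eqVneq v 0; first by rewrite linear0 vnorm0 mulr0.
have vp : 0 < vnorm v.
  by rewrite lt0r vnorm_ge0 andbT; apply: contraNneq v0 => /vnorm_eq0 ->.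
rewrite -ler_pdivrMr//.
apply: sup_upper_bound; first exact: opnorm_has_sup.
exists ((vnorm v)^-1%:C *: v).
  rewrite /= normrZ ger0_norm ?ler0c ?invr_ge0 ?vnorm_ge0//.
  by rewrite vnormE -[_ * _]rmorphM/= mulVf// gt_eqF.
rewrite linearZ/= -[LHS]/(vnorm _) vnormZ ger0_norm ?ler0c ?invr_ge0 ?vnorm_ge0//.
by rewrite mulrC.
Qed.

Lemma opnorm_ge0 T : 0 <= opnorm T.
Proof.
apply: sup_upper_bound; first exact: opnorm_has_sup.
by exists 0; rewrite /= ?normr0// linear0 normr0.
Qed.

Lemma opnorm_le T (M : R) : 0 <= M ->
  (forall v, vnorm (T v) <= M * vnorm v) -> opnorm T <= M.
Proof.
move=> M0 TM; apply: ge_sup.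
  by exists (complex.Re `|T 0|), 0 => //=; rewrite normr0.
move=> _ [v /= v1 <-]; apply: le_trans (TM v) _.
by rewrite ler_piMr// -lecR -vnormE.
Qed.

Lemma opnorm0 : opnorm (0 : boundedOp H) = 0.
Proof.
apply/le_anti; rewrite opnorm_ge0 andbT.
by apply: opnorm_le => // v; rewrite /= vnorm0 mul0r.
Qed.

Lemma opnorm0_eq0 T : opnorm T <= 0 -> T = 0.
Proof.
move=> T0; apply: bop_eqP => v; apply: vnorm_eq0; apply/le_anti.
rewrite vnorm_ge0 andbT (le_trans (opnorm_bound T v))//.
by rewrite mulr_le0_ge0 ?vnorm_ge0.
Qed.

Lemma opnormD S T : opnorm (S + T) <= opnorm S + opnorm T.
Proof.
apply: opnorm_le => [|v]; first by rewrite addr_ge0 ?opnorm_ge0.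
by rewrite mulrDl (le_trans (vnormD _ _))// lerD ?opnorm_bound.
Qed.

Lemma opnormN T : opnorm (- T) = opnorm T.
Proof.
by congr sup; apply/seteqP; split=> _ [v v1 <-]; exists v; rewrite //= normrN.
Qed.

Lemma opnormB S T : opnorm (S - T) = opnorm (T - S).
Proof. by rewrite -opnormN opprB. Qed.

Lemma opnormM S T : opnorm (S * T) <= opnorm S * opnorm T.
Proof.
apply: opnorm_le => [|v]; first by rewrite mulr_ge0 ?opnorm_ge0.
rewrite -mulrA (le_trans (opnorm_bound S _))//.
by rewrite ler_wpM2l ?opnorm_ge0 ?opnorm_bound.
Qed.

Lemma opnorm1 : opnorm (1 : boundedOp H) <= 1.
Proof. by apply: opnorm_le => // v; rewrite mul1r. Qed.

(** One half of the C*-identity: |T v|^2 = <v, S (T v)> when S is the adjoint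
of T. *)
Lemma opnorm_sqr_le T S : is_adjoint T S -> opnorm T ^+ 2 <= opnorm (S * T).
Proof.
move=> TS; rewrite -[leRHS]sqr_sqrtr ?opnorm_ge0//.
rewrite ler_sqr ?nnegrE ?opnorm_ge0 ?sqrtr_ge0//.
apply: opnorm_le => [|v]; first exact: sqrtr_ge0.
rewrite -ler_sqr ?nnegrE ?mulr_ge0 ?sqrtr_ge0 ?vnorm_ge0//.
rewrite exprMn sqr_sqrtr ?opnorm_ge0// -lecR -vnorm_sqr TS.
have /le_trans -> // : inner v (S (T v)) <= `|inner v (S (T v))|.
  by rewrite -TS vnorm_sqr ger0_norm// ler0c exprn_ge0 ?vnorm_ge0.
apply: le_trans (inner_Cauchy_Schwarz _ _) _; rewrite lecR mulrC expr2 mulrA.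
by rewrite ler_wpM2r ?vnorm_ge0//; exact: (opnorm_bound (S * T)).
Qed.

Lemma is_adjointC T S : is_adjoint T S -> is_adjoint S T.
Proof. by move=> TS u v; rewrite innerC -TS -innerC. Qed.

(** |S|^2 <= |T S| <= |T| |S|; cancel |S|. *)
Lemma opnorm_adjoint_le T S : is_adjoint T S -> opnorm S <= opnorm T.
Proof.
move=> /is_adjointC ST; have := le_trans (opnorm_sqr_le ST) (opnormM _ _).
have [->|S0] := eqVneq (opnorm S) 0; first by rewrite opnorm_ge0.
by rewrite expr2 ler_pM2r// lt0r S0 opnorm_ge0.
Qed.

End Norms.

(** * Geometrically convergent sequences of operators *)

Section Limits.
Context {R : realType} {H : hilbertType R}.
Local Notation "x %:C" := (real_complex R x).

Lemma geometric_lt (c e : R) : 0 < e -> exists n, c / 2 ^+ n < e.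
Proof.
move=> e0; exists (Num.bound (c / e)).
rewrite ltr_pdivrMr ?exprn_gt0// -ltr_pdivrMl// mulrC.
have [ce0|ce0] := leP 0 (c / e); last by rewrite (lt_trans ce0)// exprn_gt0.
rewrite (lt_trans (archi_boundP ce0))// -natrX ltr_nat.
exact: ltn_expl.
Qed.

(** Identities between limits (linearity, adjunction, invertibility,
multiplicativity) are proved by bounding their defect by a multiple of 1/2^n
for every n. *)
Lemma geometric_le0 (x c : R) : (forall n, x <= c / 2 ^+ n) -> x <= 0.
Proof.
move=> xc; rewrite leNgt; apply/negP => /(geometric_lt c)[n].
by rewrite ltNge xc.
Qed.

Lemma geometric_cvg (u : nat -> H) (c : R) :
  (forall n, vnorm (u n.+1 - u n) <= c / 2 ^+ n) ->
  exists l, forall n, vnorm (l - u n) <= (2 * c) / 2 ^+ n.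
Proof.
move=> uc.
have c0 : 0 <= c.
  by have := le_trans (vnorm_ge0 _) (uc 0); rewrite expr0 divr1.
have tail n k : vnorm (u (n + k)%N - u n) <= 2 * c / 2 ^+ n.
  (* The exact partial sum of the geometric series makes the induction work. *)
  suff : vnorm (u (n + k)%N - u n) <= 2 * c / 2 ^+ n - 2 * c / 2 ^+ (n + k).
    move/le_trans; apply; rewrite lerBlDr lerDl.
    by rewrite divr_ge0 ?mulr_ge0 ?exprn_ge0.
  elim: k => [|k IH]; first by rewrite addn0 !subrr vnorm0.
  rewrite -(subrKA (u (n + k)%N)) (le_trans (vnormD _ _))//.
  rewrite addnS (le_trans (lerD (uc _) IH))// exprSr.
  by rewrite invfM; lra.
have cvu : cvg (u n @[n --> \oo])%classic.
  apply/cauchy_cvgP/cauchy_exP => e e0.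
  have eR : e = (complex.Re e)%:C by rewrite RRe_real// gtr0_real.
  have /(geometric_lt (2 * c))[n ne] : 0 < complex.Re e by rewrite -ltcR -eR.
  exists (u n); exists n => // m /= nm.
  rewrite -ball_normE/= -normrN opprB vnormE eR ltcR.
  by rewrite -(subnKC nm) (le_lt_trans (tail _ _)).
exists (lim (u n @[n --> \oo]))%classic => n.
apply/ler_addgt0Pr => e e0.
have eC0 : 0 < e%:C by rewrite ltcR.
have /cvgrPdist_lt/(_ _ eC0)[N _ uN] := cvu.
have /uN : (N <= n + N)%N by rewrite leq_addl.
rewrite /= vnormE ltcR => le.
rewrite -(subrKA (u (n + N)%N)) (le_trans (vnormD _ _))// addrC.
by rewrite lerD ?tail// ltW.
Qed.

(** The pointwise limit is linear and bounded because the error of T_ n at v is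
at most 2c/2^n times the norm of v, uniformly in v. *)
Lemma bop_geometric_cvg (T_ : nat -> boundedOp H) (c : R) :
  (forall n, opnorm (T_ n.+1 - T_ n) <= c / 2 ^+ n) ->
  exists T, forall n, opnorm (T - T_ n) <= (2 * c) / 2 ^+ n.
Proof.
move=> Tc.
have c0 : 0 <= c.
  by have := le_trans (opnorm_ge0 _) (Tc 0); rewrite expr0 divr1.
have /choice[f fT] v : exists l, forall n,
    vnorm (l - T_ n v) <= (2 * c * vnorm v) / 2 ^+ n.
  have [|l lT] := @geometric_cvg (fun n => T_ n v) (c * vnorm v).
    move=> n; rewrite -[_ - _]/((T_ n.+1 - T_ n) v).
    rewrite (le_trans (opnorm_bound _ _))// mulrAC.
    by rewrite ler_wpM2r ?vnorm_ge0.
  by exists l => n; rewrite -(mulrA 2).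
have f_linear : linear f.
  move=> a u v; apply/eqP; rewrite -subr_eq0; apply/eqP/vnorm_eq0/le_anti.
  rewrite vnorm_ge0 andbT; apply: (@geometric_le0 _ (2 * c * vnorm (a *: u + v)
    + complex.Re `|a| * (2 * c * vnorm u) + 2 * c * vnorm v)) => n.
  have -> : f (a *: u + v) - (a *: f u + f v) =
      (f (a *: u + v) - T_ n (a *: u + v)) - a *: (f u - T_ n u)
      - (f v - T_ n v).
    rewrite [T_ n _]bop_linear scalerBr -[RHS]addrA -opprD addrACA -opprD opprB.
    by rewrite [RHS]addrA subrK.
  rewrite (le_trans (vnormD _ _))// vnormN mulrDl lerD//.
  rewrite (le_trans (vnormD _ _))// vnormN mulrDl lerD//.
  rewrite vnormZ -[leRHS]mulrA ler_wpM2l//.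
  by rewrite -ler0c RRe_real// ger0_real.
have f_bounded : exists M : R[i], forall v, `|f v| <= M * `|v|.
  exists (2 * c + opnorm (T_ 0))%:C => v.
  rewrite !vnormE -rmorphM lecR -[f v](subrK (T_ 0 v)).
  rewrite (le_trans (vnormD _ _))// mulrDl lerD ?opnorm_bound//.
  by have := fT v 0; rewrite expr0 divr1.
exists (BoundedOp f_linear f_bounded) => n.
apply: opnorm_le => [|v].
  by rewrite divr_ge0 ?mulr_ge0 ?exprn_ge0.
by rewrite mulrAC; exact: fT.
Qed.

Lemma is_adjointB (S S' T T' : boundedOp H) :
  is_adjoint S S' -> is_adjoint T T' -> is_adjoint (S - T) (S' - T').
Proof.
by move=> SS' TT' u v; rewrite /= linearBl linearBr/= SS' TT'.
Qed.

Lemma is_adjointD (S S' T T' : boundedOp H) :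
  is_adjoint S S' -> is_adjoint T T' -> is_adjoint (S + T) (S' + T').
Proof.
by move=> SS' TT' u v; rewrite /= linearDl linearDr/= SS' TT'.
Qed.

Lemma is_adjointM (S S' T T' : boundedOp H) :
  is_adjoint S S' -> is_adjoint T T' -> is_adjoint (S * T) (T' * S').
Proof. by move=> SS' TT' u v; rewrite /= SS' TT'. Qed.

Lemma is_adjoint1 : is_adjoint (1 : boundedOp H) 1.
Proof. by []. Qed.

(** Adjunction has norm at most 1, so the adjoints S_ n converge as well, and
their limit S is the adjoint of the limit T.  Multiplication being continuous,
S and T are inverse to each other. *)
Lemma unitary_geometric_cvg (T_ S_ : nat -> boundedOp H) (c : R) :
  (forall n, is_adjoint (T_ n) (S_ n)) ->
  (forall n, opnorm (T_ n.+1 - T_ n) <= c / 2 ^+ n) ->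
  (forall n, opnorm (1 - S_ n * T_ n) <= c / 2 ^+ n) ->
  (forall n, opnorm (1 - T_ n * S_ n) <= c / 2 ^+ n) ->
  exists U : unitaryOp H, forall n, opnorm (uop_val U - T_ n) <= (2 * c) / 2 ^+ n.
Proof.
move=> TS Tc ST1 TS1.
have [T TT] := bop_geometric_cvg Tc.
have [S SS] : exists S, forall n, opnorm (S - S_ n) <= (2 * c) / 2 ^+ n.
  apply: bop_geometric_cvg => n; apply: le_trans (Tc n).
  exact/opnorm_adjoint_le/is_adjointB.
have TSa : is_adjoint T S.
  move=> u v; apply/eqP; rewrite -subr_eq0 -normr_le0.
  have -> : `|inner (T u) v - inner u (S v)| =
     (complex.Re `|inner (T u) v - inner u (S v)|)%:C.
    by rewrite RRe_real// ger0_real.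
  rewrite lecR; apply: (@geometric_le0 _ (2 * (2 * c * vnorm u * vnorm v))) => n.
  rewrite -lecR RRe_real ?ger0_real//.
  have -> : inner (T u) v - inner u (S v) =
     inner ((T - T_ n) u) v - inner u ((S - S_ n) v).
    by rewrite /= linearBl linearBr/= TS opprB addrA subrK.
  rewrite (le_trans (ler_normB _ _))//.
  rewrite (le_trans (lerD (inner_Cauchy_Schwarz _ _) (inner_Cauchy_Schwarz _ _)))//.
  rewrite -rmorphD lecR.
  have -> : 2 * (2 * c * vnorm u * vnorm v) / 2 ^+ n =
    (2 * c / 2 ^+ n * vnorm u) * vnorm v + vnorm u * (2 * c / 2 ^+ n * vnorm v).
    by ring.
  rewrite lerD// ?ler_wpM2r ?ler_wpM2l ?vnorm_ge0//.
    by rewrite (le_trans (opnorm_bound _ _))// ler_wpM2r ?vnorm_ge0.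
  by rewrite (le_trans (opnorm_bound _ _))// ler_wpM2r ?vnorm_ge0.
have c0 : 0 <= c.
  by have := le_trans (opnorm_ge0 _) (Tc 0); rewrite expr0 divr1.
have product_one (A B : boundedOp H) (A_ B_ : nat -> boundedOp H) :
    (forall n, opnorm (A - A_ n) <= (2 * c) / 2 ^+ n) ->
    (forall n, opnorm (B - B_ n) <= (2 * c) / 2 ^+ n) ->
    (forall n, opnorm (1 - A_ n * B_ n) <= c / 2 ^+ n) -> A * B = 1.
  move=> AA BB AB; apply/eqP; rewrite -subr_eq0; apply/eqP/opnorm0_eq0.
  apply: (@geometric_le0 _
    (2 * c * opnorm B + (opnorm A + 2 * c) * (2 * c) + c)) => n.
  have -> : A * B - 1 =
      (A - A_ n) * B + A_ n * (B - B_ n) - (1 - A_ n * B_ n).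
    by rewrite mulrBl mulrBr subrKA opprB subrKA.
  rewrite (le_trans (opnormD _ _))// opnormN [leRHS]mulrDl lerD//.
  rewrite (le_trans (opnormD _ _))// [leRHS]mulrDl lerD//.
    by rewrite (le_trans (opnormM _ _))// [leRHS]mulrAC ler_wpM2r ?opnorm_ge0.
  rewrite (le_trans (opnormM _ _))// -[leRHS]mulrA ler_pM ?opnorm_ge0//.
  rewrite -[A_ n](subrK A) (le_trans (opnormD _ _))// addrC lerD2l opnormB.
  rewrite (le_trans (AA n))// ler_pdivrMr ?exprn_gt0// ler_peMr ?mulr_ge0//.
  by rewrite exprn_ege1// ler1n.
have ST : S * T = 1 by exact: product_one SS TT ST1.
have TS' : T * S = 1 by exact: product_one TT SS TS1.
by exists (UnitaryOp (ex_intro _ S (And3 TSa TS' ST))).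
Qed.

End Limits.

(** * Approximate unitaries are close to unitaries *)

Section NewtonSchulz.
Context {R : realType} {H : hilbertType R}.
Implicit Types (S T X : boundedOp H).

Fact half_linear : linear (fun v : H => 2^-1 *: v).
Proof. by move=> a u v; rewrite scalerDr !scalerA mulrC. Qed.

Fact half_bounded : exists M : R[i], forall v : H, `|2^-1 *: v| <= M * `|v|.
Proof. by exists `|2^-1| => v; rewrite normrZ. Qed.

(** The ring of bounded operators has no scalar multiplication, so halving is
multiplication by this central self-adjoint element. *)
Definition half : boundedOp H := BoundedOp half_linear half_bounded.

Lemma halfC T : T * half = half * T.
Proof. by apply: bop_eqP => v; rewrite /= linearZ. Qed.

Lemma half_double T : half * T + half * T = T.
Proof.
apply: bop_eqP => v; rewrite /= -scalerDl.
by rewrite -[2^-1]div1r -splitr scale1r.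
Qed.

Lemma half_adjoint : is_adjoint half half.
Proof.
move=> u v; rewrite /= linearZl_LR linearZr_LR/= fmorphV; congr (_^-1 * _).
by rewrite rmorph_nat.
Qed.

Lemma opnorm_half T : opnorm (half * T) <= opnorm T / 2.
Proof.
apply: opnorm_le => [|v]; first by rewrite divr_ge0 ?opnorm_ge0.
rewrite /= vnormZ [leRHS]mulrAC [leRHS]mulrC.
have -> : complex.Re `|2^-1 : R[i]| = 2^-1.
  by apply: (@complexI R); rewrite RRe_real ?ger0_real// normfV normr_nat fmorphV/= rmorph_nat.
by rewrite ler_wpM2l ?opnorm_bound ?invr_ge0 ?ler0n.
Qed.

(** First-order Taylor polynomial at 1 of the inverse square root of X. *)
Definition correction X := 1 + half * (1 - X).

Lemma correction_adjoint X :
  is_adjoint X X -> is_adjoint (correction X) (correction X).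
Proof.
move=> XX; apply: is_adjointD; first exact: is_adjoint1.
rewrite -[X in is_adjoint _ X]halfC; apply: is_adjointM half_adjoint _.
exact: is_adjointB (@is_adjoint1 R H) XX.
Qed.

(** With a = (1 - X) / 2 the new residual is 3 a^2 + 2 a^3, that is, quadratic
in the old one; for e <= 1/2 this gives at least halving, which is all the
geometric convergence needs. *)
Lemma newton_residual X (e : R) : e <= 2^-1 -> opnorm (1 - X) <= e ->
  opnorm (1 - correction X * X * correction X) <= e / 2.
Proof.
move=> e2 Xe; have := opnorm_half (1 - X); have := half_double (1 - X).
rewrite /correction; set a := half * (1 - X) => aa ae.
have -> : X = 1 - (a + a) by rewrite aa subKr.
have -> : 1 - (1 + a) * (1 - (a + a)) * (1 + a) =
    a * a + a * a + a * a + (a * a * a + a * a * a).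
  have -> : (1 + a) * (1 - (a + a)) = 1 - a - (a * a + a * a).
    rewrite mulrDl mul1r (mulrBr a) mulr1 (mulrDr a) [in LHS]opprD addrA.
    by rewrite (addrA 1) subrK.
  rewrite mulrDr mulr1 (mulrBl a) (mulrBl a 1) mul1r (mulrDl _ _ a).
  rewrite addrACA -(addrA 1) [- a + _]addrA addNr.
  by rewrite sub0r opprD addrA subKr opprD !opprK !addrA.
have n0 := opnorm_ge0 a; have e0 := opnorm_ge0 (1 - X).
set n := opnorm a in ae n0 *.
have na2 : opnorm (a * a) <= n * n by exact: opnormM.
have na3 : opnorm (a * a * a) <= n * n * n.
  by rewrite (le_trans (opnormM _ _))// ler_wpM2r.
have : opnorm (a * a + a * a + a * a + (a * a * a + a * a * a)) <=
    n * n + n * n + n * n + (n * n * n + n * n * n).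
  by do ![rewrite (le_trans (opnormD _ _))// lerD//].
nra.
Qed.

(** The pair consists of an operator and its adjoint; carrying both avoids
having to construct adjoints of general bounded operators. *)
Definition newton_step (p : boundedOp H * boundedOp H) :=
  (p.1 * correction (p.2 * p.1), correction (p.2 * p.1) * p.2).

(** This intertwining makes the step symmetric in T and S, so the residuals of
S T and of T S obey the same recursion. *)
Lemma correctionC T S : T * correction (S * T) = correction (T * S) * T.
Proof.
rewrite /correction mulrDr mulrDl mulr1 mul1r mulrA halfC -!mulrA.
by rewrite mulrBr mulrBl mulr1 mul1r !mulrA.
Qed.

(** The Newton-Schulz iterates stay bounded by 2 in norm and their residuals
halve at each step, so that the n-th increment is at most e/2^n. *)
Lemma exists_unitary_near T S (e : R) : is_adjoint T S -> e <= 2^-1 ->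
  opnorm (1 - S * T) <= e -> opnorm (1 - T * S) <= e ->
  exists U : unitaryOp H, opnorm (uop_val U - T) <= 2 * e.
Proof.
move=> TS e2 STe TSe; pose p n := iter n newton_step (T, S).
have e0 : 0 <= e by apply: le_trans STe; exact: opnorm_ge0.
have inv n : [/\ is_adjoint (p n).1 (p n).2,
    opnorm (1 - (p n).2 * (p n).1) <= e / 2 ^+ n &
    opnorm (1 - (p n).1 * (p n).2) <= e / 2 ^+ n].
  elim: n => [|n [an STn TSn]]; first by rewrite expr0 divr1.
  have en2 : e / 2 ^+ n <= 2^-1.
    rewrite ler_pdivrMr ?exprn_gt0// (le_trans e2)//.
    by rewrite ler_peMr ?invr_ge0 ?ler0n// exprn_ege1// ler1n.
  rewrite [p n.+1]iterS -/(p n); move: (p n) an STn TSn => [A B]/= an STn TSn.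
  split.
  - exact/(is_adjointM an)/correction_adjoint/is_adjointM/an/is_adjointC.
  - by rewrite exprSr invfM mulrA mulrA -(mulrA _ B A) newton_residual.
  - rewrite correctionC (_ : correction (B * A) * B = B * correction (A * B)).
      by rewrite exprSr invfM mulrA mulrA -(mulrA _ A B) newton_residual.
    by rewrite correctionC.
have [n|n|n|n|U /(_ 0)] := @unitary_geometric_cvg R H
    (fun n => (p n).1) (fun n => (p n).2) e; last first.
- by rewrite expr0 divr1; exists U.
- by have [] := inv n.
- by have [] := inv n.
- have [an STn TSn] := inv n; rewrite [p n.+1]iterS.
  rewrite -/(p n) /= /correction mulrDr mulr1 addrAC subrr add0r.
  rewrite (le_trans (opnormM _ _))//.
  have : opnorm (p n).1 ^+ 2 <= 1 + e.
    rewrite (le_trans (opnorm_sqr_le an))//.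
    rewrite -[_ * _](subKr 1) (le_trans (opnormD _ _))// opnormN lerD ?opnorm1//.
    rewrite (le_trans STn)// ler_pdivrMr ?exprn_gt0// ler_peMr//.
    by rewrite exprn_ege1// ler1n.
  have := opnorm_half (1 - (p n).2 * (p n).1); have := opnorm_ge0 (p n).1.
  have := opnorm_ge0 (half * (1 - (p n).2 * (p n).1)).
  set x := opnorm _; set y := opnorm _; set z := opnorm _ in STn *.
  move=> x0 y0 xz yz.
  have y2 : y <= 2 by nra.
  rewrite (le_trans (ler_wpM2r x0 y2))//; lra.
- by have [] := inv n.
Qed.

End NewtonSchulz.

(** * Positive definite maps and the improvement step *)

Section Stability.
Context {R : realType} {H : hilbertType R} {G : groupType}.
Implicit Types (phi : G -> unitaryOp H) (psi : G -> boundedOp H).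

(** For x other than 1, positivity of the matrix of psi at (1, x), taken at the
vector (u, w), makes <psi(x) w, u> + <psi(x^-1) u, w> real for all u and w.
Using this for i u as well as u, each term is the conjugate of the other. *)
Lemma positive_definite_adjoint psi : unital psi -> positive_definite psi ->
  forall x, is_adjoint (psi x) (psi x^-1%g).
Proof.
move=> psi1 pd x; have [->|x1] := eqVneq x 1%g; first by rewrite invg1 psi1.
pose y (i : 'I_2) := if i == ord0 then 1%g else x.
have y_inj : injective y.
  move=> [[|[|//]] i] [[|[|//]] j]; rewrite /y/= => xy; apply: val_inj => //=.
    by move/eqP: xy; rewrite eq_sym (negbTE x1).
  by move/eqP: xy; rewrite (negbTE x1).
have cross_real u w :
    inner (psi x w) u + inner (psi x^-1%g u) w \is Num.real.
  pose v (i : 'I_2) := if i == ord0 then u else w.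
  have := pd 2 y y_inj v; rewrite /inner_pow /opmx_apply.
  rewrite !big_ord_recl !big_ord0 /y /v/= !addr0 invg1 !mul1g mulVg mulg1 psi1.
  rewrite /= !linearDl/= => /ger0_real.
  have uR : inner u u \is Num.real by rewrite ger0_real ?dnorm_ge0.
  have wR : inner w w \is Num.real by rewrite ger0_real ?dnorm_ge0.
  move=> /(fun h => rpredB (rpredB h uR) wR).
  set a := inner u u; set b := inner (psi x w) u.
  set c := inner (psi _ u) w; set d := inner w w.
  by rewrite (_ : a + b + (c + d) - a - d = b + c)//; ring.
move=> w u; rewrite [RHS]innerC.
have /CrealP := cross_real u w; have /CrealP := cross_real ('i *: u) w.
rewrite [psi _ ('i *: _)]linearZ linearZl_LR linearZr_LR/= conjCi.
set a := inner (psi x w) u; set b := inner (psi x^-1%g u) w.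
rewrite !rmorphD !rmorphM/= rmorphN/= !conjCi opprK => e1 e2.
have e3 : a^* - b^* = b - a.
  by apply: (mulfI (neq0Ci R[i])); rewrite !mulrBr -mulNr e1; ring.
apply: (@mulfI _ 2); first by rewrite pnatr_eq0.
have -> : 2 * a = (a + b) - (b - a) by ring.
by rewrite -e2 -e3; ring.
Qed.

Lemma opnorm_unitary (U : unitaryOp H) : opnorm (uop_val U) <= 1.
Proof.
have [S [US _ SU]] := uopP U; rewrite -(@ler_sqr R) ?nnegrE ?opnorm_ge0//.
by rewrite expr1n (le_trans (opnorm_sqr_le US))// SU opnorm1.
Qed.

(** Controls a multiplicative defect after perturbation: of psi into phi, and of
the n-th iterate into the limit. *)
Lemma opnorm_mul_defect (P A B P' A' B' : boundedOp H) :
  opnorm (P - A * B) <= opnorm (P - P') + opnorm (P' - A' * B')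
    + opnorm (A - A') * opnorm B' + opnorm A * opnorm (B - B').
Proof.
have -> : P - A * B =
    (P - P') + (P' - A' * B') - (A - A') * B' - A * (B - B').
  by rewrite subrKA mulrBl mulrBr !opprB !subrKA.
rewrite (le_trans (opnormD _ _))// opnormN lerD ?opnormM//.
rewrite (le_trans (opnormD _ _))// opnormN lerD ?opnormM//.
exact: opnormD.
Qed.

(** The constant 9 is 2 + 1 + 2*2 + 2: an error of 2e for each of the three
replacements of psi by phi, one of them multiplied by the bound 2 on the norm
of psi, and e for the defect of psi itself. *)
Lemma positive_definite_near_unitary psi (e : R) : e <= 2^-1 ->
  unital psi -> positive_definite psi -> eps_representation e psi ->
  exists phi, eps_representation (9 * e) (fun x => uop_val (phi x)) /\
    forall x, opnorm (uop_val (phi x) - psi x) <= 2 * e.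
Proof.
move=> e2 psi1 pd rep.
have /choice[phi phi_psi] x :
    exists U : unitaryOp H, opnorm (uop_val U - psi x) <= 2 * e.
  apply: (exists_unitary_near (positive_definite_adjoint psi1 pd x)) => //.
    by have := rep x^-1%g x; rewrite mulVg psi1.
  by have := rep x x^-1%g; rewrite mulgV psi1.
exists phi; split=> // x y.
have psi2 z : opnorm (psi z) <= 2.
  rewrite -[psi z](subrK (uop_val (phi z))) (le_trans (opnormD _ _))//.
  rewrite opnormB; have := phi_psi z; have := opnorm_unitary (phi z); lra.
have e0 : 0 <= e by exact: le_trans (opnorm_ge0 _) (rep 1%g 1%g).
have -> : 9 * e = 2 * e + e + (2 * e * 2) + 1 * (2 * e) by ring.
apply: le_trans (opnorm_mul_defect _ _ _ (psi (x * y)%g) (psi x) (psi y)) _.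
by rewrite !lerD ?ler_pM ?opnorm_ge0 ?opnorm_unitary.
Qed.

(** Iterate the hypothesis with e, e/2, e/4 and so on.  The n-th step moves each
value by at most C e/2^n, so the values converge to unitaries, the total
displacement is at most 2 C e, and the defect of the limit is zero. *)
Lemma stable_of_halving (C d : R) :
  (forall e, 0 < e -> e < d -> forall phi,
    eps_representation e (fun x => uop_val (phi x)) ->
    exists phi', eps_representation (e / 2) (fun x => uop_val (phi' x)) /\
      forall x, opnorm (uop_val (phi' x) - uop_val (phi x)) <= C * e) ->
  forall e, 0 < e -> e < d -> forall phi,
    eps_representation e (fun x => uop_val (phi x)) ->
    exists pi : {multiplicative G -> unitaryOp H},
      forall x, opnorm (uop_val (pi x) - uop_val (phi x)) <= 2 * C * e.
Proof.
move=> halving e e0 ed phi rep.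
pose e_ n := e / 2 ^+ n.
have e_0 n : 0 < e_ n by rewrite divr_gt0 ?exprn_gt0.
have e_d n : e_ n < d.
  rewrite (le_lt_trans _ ed)// ler_pdivrMr ?exprn_gt0// ler_peMr ?(ltW e0)//.
  by rewrite exprn_ege1// ler1n.
pose R_ n := {phi : G -> unitaryOp H |
   eps_representation (e_ n) (fun x => uop_val (phi x))}.
have step n (p : R_ n) : {q : R_ n.+1 | forall x,
    opnorm (uop_val (sval q x) - uop_val (sval p x)) <= C * e_ n}.
  apply/cid; case: p => p pn /=.
  have [q [qn pq]] := halving _ (e_0 n) (e_d n) p pn.
  have qn1 : eps_representation (e_ n.+1) (fun x => uop_val (q x)).
    by rewrite /e_ exprSr invfM mulrA.
  by exists (exist _ q qn1).
have rep0 : eps_representation (e_ 0) (fun x => uop_val (phi x)).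
  by rewrite /e_ expr0 divr1.
pose p := fix p n : R_ n :=
  if n is m.+1 then sval (step m (p m)) else exist _ phi rep0.
pose f n := sval (p n).
have f_rep n : eps_representation (e_ n) (fun x => uop_val (f n x)).
  exact: svalP (p n).
have f_step n x : opnorm (uop_val (f n.+1 x) - uop_val (f n x)) <= C * e / 2 ^+ n.
  by rewrite -mulrA; exact: svalP (step n (p n)) x.
have /choice[pi fpi] x : exists U : unitaryOp H, forall n,
    opnorm (uop_val U - uop_val (f n x)) <= (2 * (C * e)) / 2 ^+ n.
  have fS n := svalP (cid (uopP (f n x))).
  have Ce0 n : opnorm (0 : boundedOp H) <= C * e / 2 ^+ n.
    by rewrite opnorm0 (le_trans (opnorm_ge0 _) (f_step n x)).
  apply: (unitary_geometric_cvg (S_ := fun n => adjoint (f n x))) => n //.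
  - by have [] := fS n.
  - by have [_ _ ->] := fS n; rewrite subrr.
  - by have [_ -> _] := fS n; rewrite subrr.
have piM : {morph pi : x y / (x * y)%g >-> (x * y)%g}.
  move=> x y; apply: uop_inj; apply/eqP; rewrite -subr_eq0; apply/eqP/opnorm0_eq0.
  apply: (geometric_le0 (c := 6 * (C * e) + e)) => n.
  have -> : (6 * (C * e) + e) / 2 ^+ n = 2 * (C * e) / 2 ^+ n + e_ n
      + 2 * (C * e) / 2 ^+ n * 1 + 1 * (2 * (C * e) / 2 ^+ n).
    by rewrite /e_; ring.
  apply: le_trans (opnorm_mul_defect _ _ _ (uop_val (f n (x * y)%g))
    (uop_val (f n x)) (uop_val (f n y))) _.
  by rewrite !lerD ?ler_pM ?opnorm_ge0 ?opnorm_unitary// f_rep.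
pose piHB := isMultiplicative.Build G (unitaryOp H) pi piM.
pose piM' : {multiplicative G -> unitaryOp H} := HB.pack pi piHB.
exists piM' => x.
by have := fpi x 0; rewrite expr0 divr1 mulrA.
Qed.

Section UnitaryRepresentation.
Context (pi : {multiplicative G -> unitaryOp H}).

Lemma unitary_rep1 : uop_val (pi 1%g) = 1.
Proof.
suff -> : pi 1%g = 1%g by [].
by apply: (mulgI (pi 1%g)); rewrite -gmulfM !mulg1.
Qed.

Lemma unitary_repM x y : uop_val (pi (x * y)%g) = uop_val (pi x) * uop_val (pi y).
Proof. by rewrite gmulfM. Qed.

Lemma unitary_rep_adjoint x : is_adjoint (uop_val (pi x)) (uop_val (pi x^-1%g)).
Proof.
have [S [xS _ Sx]] := uopP (pi x).
suff -> : uop_val (pi x^-1%g) = S by [].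
by rewrite -[LHS]mul1r -Sx -mulrA -unitary_repM mulgV unitary_rep1 mulr1.
Qed.

(** The quadratic form at v is the squared norm of the sum of the vectors
pi(x_j) v_j. *)
Lemma unitary_rep_positive_definite :
  positive_definite (fun x => uop_val (pi x)).
Proof.
move=> n x _ v; pose w := \sum_(j < n) uop_val (pi (x j)) (v j).
suff -> : inner_pow (opmx_apply (fun i j => uop_val (pi ((x i)^-1 * x j)%g)) v) v
    = inner w w by exact: dnorm_ge0.
have -> : inner w w = \sum_(i < n) inner w (uop_val (pi (x i)) (v i)).
  exact: linear_sumr.
apply: eq_bigr => i _; rewrite -(is_adjointC (unitary_rep_adjoint (x i))) linear_sum.
by congr (inner _ _); apply: eq_bigr => j _; rewrite unitary_repM.
Qed.

End UnitaryRepresentation.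

End Stability.

(** * The equivalence *)

Unset Implicit Arguments.
Set Strict Implicit.

Theorem proposition1p2 (R : realType) (G : groupType) (H : hilbertType R) :
  (exists kappa delta : R,
     [/\ 0 < kappa, 0 < delta, delta < 1 &
      forall eps : R, 0 < eps -> eps < delta ->
      forall phi : G -> unitaryOp H,
        eps_representation eps (fun x => uop_val (phi x)) ->
      exists pi : {multiplicative G -> unitaryOp H},
        forall x : G,
          opnorm (uop_val (phi x) - uop_val (pi x)) <= kappa * eps])
  <->
  (exists kappa1 kappa2 delta p : R,
     [/\ 0 < kappa1 /\ 0 < kappa2, 0 < delta /\ delta < 1, 1 < p &
      forall eps : R, 0 < eps -> eps < 1 ->
        kappa1 * eps `^ (p - 1) <= delta `^ (p - 1) ->
      forall phi : G -> unitaryOp H,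
        eps_representation eps (fun x => uop_val (phi x)) ->
      exists psi : G -> boundedOp H,
        [/\ unital psi, positive_definite psi,
            eps_representation (kappa1 * eps `^ p) psi &
            forall x : G, opnorm (uop_val (phi x) - psi x) <= kappa2 * eps]]).
Proof.
split=> [[kappa [delta [k0 d0 d1 stable]]]|].
  exists 1, kappa, (delta / 2), 2; split=> [||//|eps e0 e1].
  - by split.
  - by split; lra.
  - by rewrite ltr1n.
  have -> : 2 - 1 = 1 :> R by ring.
  rewrite mul1r !powRr1 ?divr_ge0 ?(ltW e0) ?(ltW d0)// => ed phi rep.
  have [|pi phi_pi] := stable eps e0 _ phi rep; first by lra.
  exists (fun x => uop_val (pi x)); split=> //.
  - exact: unitary_rep1.
  - exact: unitary_rep_positive_definite.
  - by move=> x y; rewrite unitary_repM subrr opnorm0 mul1r powR_ge0.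
move=> [k1 [k2 [d [p [[k10 k20] [d0 d1] p1 stable]]]]].
have q0 : 0 < p - 1 by rewrite subr_gt0.
(* m is chosen so that the defect k1 e^p = k1 e^(p-1) e of psi is at most
   e / 18; the next defect 9 k1 e^p is then at most e / 2. *)
pose m := Num.min (d `^ (p - 1)) 18^-1.
have m0 : 0 < m by rewrite lt_min powR_gt0//= invr_gt0 ltr0n.
pose delta := Num.min 2^-1 ((m / k1) `^ (p - 1)^-1).
exists (2 * (k2 + 1)), delta; split.
- by rewrite mulr_gt0 ?addr_gt0.
- by rewrite lt_min invr_gt0 ltr0n powR_gt0 ?divr_gt0.
- by rewrite gt_min; apply/orP; left; lra.
move=> eps e0 ed phi rep.
suff halving e : 0 < e -> e < delta -> forall phi : G -> unitaryOp H,
    eps_representation e (fun x => uop_val (phi x)) ->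
    exists phi' : G -> unitaryOp H,
      eps_representation (e / 2) (fun x => uop_val (phi' x)) /\
      forall x, opnorm (uop_val (phi' x) - uop_val (phi x)) <= (k2 + 1) * e.
  have [pi pi_phi] := stable_of_halving halving e0 ed rep.
  by exists pi => x; rewrite opnormB.
move=> {e0 ed rep phi} {}e0; rewrite lt_min => /andP[e2 em] phi rep.
have km : k1 * e `^ (p - 1) <= m.
  rewrite -ler_pdivlMl// mulrC.
  have -> : m / k1 = ((m / k1) `^ (p - 1)^-1) `^ (p - 1).
    by rewrite -powRrM mulVf ?powRr1 ?gt_eqF// ?divr_ge0 ?ltW.
  by rewrite ge0_ler_powR ?nnegrE ?powR_ge0 ?ltW.
have /andP[kd k18] : (k1 * e `^ (p - 1) <= d `^ (p - 1)) &&
    (k1 * e `^ (p - 1) <= 18^-1) by rewrite -le_min.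
have [|psi [psi1 pd psi_rep phi_psi]] := stable e e0 _ kd phi rep; first by lra.
have e' : k1 * e `^ p <= e / 18.
  rewrite -[p](subrK 1) powRD; last by rewrite (gt_eqF e0) implybT.
  by rewrite powRr1 ?(ltW e0)// mulrA mulrC ler_wpM2l// ltW.
have [|phi' [phi'_rep phi'_psi]] :=
  positive_definite_near_unitary _ psi1 pd psi_rep; first by lra.
exists phi'; split=> [x y|x].
  by apply: le_trans (phi'_rep x y) _; lra.
rewrite -(subrKA (psi x)) (le_trans (opnormD _ _))//.
rewrite [opnorm (psi x - _)]opnormB.
have := phi'_psi x; have := phi_psi x; lra.
Qed.
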